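(* Let $1\le p<\infty$ and $\frac1p+\frac1{p'}=1$. Then $$\big(l^p(\mathrm L)\big)'=l^{p'}(\mathrm L^* )\quad\text{and}\quad\big(l^p(\mathrm L^* )\big)'=l^{p'}(\mathrm L).$$
   Context: Setting. $\Omega\subset\mathbb R^n$ ($n\ge 1$) is a bounded open set. $\mathrm L$ is a differential operator of order $m$ with smooth coefficients in $\Omega$, equipped with linear boundary conditions (the functions satisfying them form a linear space), viewed as an operator in $L^2(\Omega)$ with domain $\mathrm{Dom}(\mathrm L)$; $\mathrm L^*$ is its adjoint, with the adjoint boundary conditions and domain $\mathrm{Dom}(\mathrm L^* )$. $\mathcal I$ is a countable subset of some $\mathbb Z^K$; $\mathrm L$ has discrete spectrum $\{\lambda_\xi\}_{\xi\in\mathcal I}\subset\mathbb C$, listed with multiplicities so that $|\lambda_j|\le|\lambda_k|$ whenever $|j|\le|k|$. There are eigenfunctions $u_\xi\in\mathrm{Dom}(\mathrm L)$, $\mathrm Lu_\xi=\lambda_\xi u_\xi$, and $v_\xi\in\mathrm{Dom}(\mathrm L^* )$, $\mathrm L^*v_\xi=\overline{\lambda_\xi}v_\xi$, with $\|u_\xi\|_{L^2}=1$ and $(u_\xi,v_\eta)_{L^2}=\delta_{\xi\eta}$, where $(f,g)_{L^2}=\int_\Omega f\overline g\,dx$; both $\{u_\xi\}$ and $\{v_\xi\}$ are Riesz bases of $L^2(\Omega)$. Put $\langle\xi\rangle=(1+|\lambda_\xi|^2)^{1/(2m)}$. Boundary conditions are preserved under limits (the spaces $\bigcap_k\mathrm{Dom}(\mathrm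 L^k)$ and $\bigcap_k\mathrm{Dom}((\mathrm L^* )^k)$ with norms $\max_{j\le k}\|\mathrm L^j\varphi\|_{L^2}$, resp. $\max_{j\le k}\|(\mathrm L^* )^j\varphi\|_{L^2}$, are complete). $\mathcal S'(\mathcal I)$ is the set of $a:\mathcal I\to\mathbb C$ with $|a(\xi)|\le C\langle\xi\rangle^M$ for some $C,M$. $l^p(\mathrm L)$ is the space of $a\in\mathcal S'(\mathcal I)$ with finite norm $\|a\|_{l^p(\mathrm L)}=(\sum_\xi|a(\xi)|^p\|u_\xi\|_{L^\infty(\Omega)}^{2-p})^{1/p}$ for $1\le p\le2$; $\|a\|_{l^p(\mathrm L)}=(\sum_\xi|a(\xi)|^p\|v_\xi\|_{L^\infty(\Omega)}^{2-p})^{1/p}$ for $2\le p<\infty$; $\|a\|_{l^\infty(\mathrm L)}=\sup_\xi|a(\xi)|\,\|v_\xi\|_{L^\infty(\Omega)}^{-1}$. $l^p(\mathrm L^* )$ is defined in the same way with the roles of $u_\xi$ and $v_\xi$ interchanged. These definitions presuppose $u_\xi,v_\xi\in L^\infty(\Omega)$. $X'$ denotes the dual of a normed space $X$; the identification of duals is with respect to the bilinear pairing $(\sigma_1,\sigma_2)=\sum_{\xi\in\mathcal I}\sigma_1(\xi)\sigma_2(\xi)$.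
   Formalization: For p < 2 it is additionally assumed that the sequences of sup norms of u_ξ and of v_ξ belong to S'(I), i.e. grow at most polynomially in ⟨ξ⟩; without this the duality fails, since l^{p'} is required to lie in S'(I). *)

(* Defs.v *)
From HB Require Import structures.
From mathcomp Require Import all_boot all_order all_algebra finmap complex.
From mathcomp Require Import all_classical all_reals all_analysis.
From mathcomp.analysis Require Import showcase.summability.

Set Implicit Arguments.
Unset Strict Implicit.
Unset Printing Implicit Defensive.
Import Order.TTheory GRing.Theory Num.Theory ComplexField ComplexField.Normc.
Import numFieldNormedType.Exports.
Local Open Scope classical_set_scope.
Local Open Scope ring_scope.
Local Open Scope complex_scope.

(* The sigma-algebra generated by the coordinates, that is, the Borel one. *)
Definition rV_display : measure_display. Proof. exact. Qed.

Section rV_measurable.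
Context {R : realType} (n : nat).
Let coords : 'I_n -> 'rV[R]_n -> measurableTypeR R := fun i x => x ord0 i.

Let rV_set0 : g_sigma_preimage coords set0.
Proof. exact: sigma_algebra0. Qed.

Let rV_setC A : g_sigma_preimage coords A -> g_sigma_preimage coords (~` A).
Proof. exact: sigma_algebraC. Qed.

Let rV_bigcup (F : _^nat) : (forall i, g_sigma_preimage coords (F i)) ->
  g_sigma_preimage coords (\bigcup_i (F i)).
Proof. exact: sigma_algebra_bigcup. Qed.

HB.instance Definition _ := @isMeasurable.Build rV_display
  'rV[R]_n (g_sigma_preimage coords) rV_set0 rV_setC rV_bigcup.

Lemma measurable_rV_coord (i : 'I_n) :
  measurable_fun [set: 'rV[R]_n] (coords i).
Proof.
move=> _ Y mY; rewrite setTI; apply: sub_sigma_algebra => /=.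
rewrite -bigcup_seq/=; exists i => /=; first by rewrite mem_index_enum.
by exists Y => //; rewrite setTI.
Qed.

Lemma measurable_fun_rV d (T : measurableType d) (f : T -> 'rV[R]_n) :
  (forall i, measurable_fun [set: T] (fun x => f x ord0 i : measurableTypeR R)) ->
  measurable_fun [set: T] f.
Proof.
move=> mf.
have H : g_sigma_preimage (fun i => coords i \o f) `<=` measurable.
  apply: smallest_sub; first exact: sigma_algebra_measurable.
  move=> A; rewrite -bigcup_seq => -[i _ [B mB <-]]; exact: mf.
move: H; rewrite g_sigma_preimage_comp => H _ A mA.
by apply: H; exists A.
Qed.
End rV_measurable.

Section lebesgue_rV_succ.
Context {R : realType} (n : nat).
Variable m : {sigma_finite_measure set 'rV[R]_n -> \bar R}.

Let T2 := (measurableTypeR R * 'rV[R]_n)%type.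

Definition rV_cons (p : T2) : 'rV[R]_n.+1 :=
  \row_i (if unlift ord0 i is Some j then p.2 ord0 j else p.1).
Definition rV_uncons (x : 'rV[R]_n.+1) : T2 :=
  (x ord0 ord0, \row_i x ord0 (lift ord0 i)).

Lemma rV_consK : cancel rV_cons rV_uncons.
Proof.
move=> [a v]; rewrite /rV_uncons /rV_cons mxE unlift_none; congr pair.
by apply/rowP => i; rewrite !mxE liftK.
Qed.

Lemma measurable_rV_cons : measurable_fun [set: T2] rV_cons.
Proof.
apply: measurable_fun_rV => i; rewrite /rV_cons.
case: (unliftP ord0 i) => [j|] ->.
- rewrite (_ : (fun _ => _) = (fun x : 'rV[R]_n => x ord0 j) \o snd).
    by apply: measurableT_comp; [exact: measurable_rV_coord|].
  by apply/funext => x; rewrite /= mxE liftK.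
- rewrite (_ : (fun _ => _) = fst) //.
  by apply/funext => x; rewrite /= mxE unlift_none.
Qed.

Lemma measurable_rV_uncons : measurable_fun [set: 'rV[R]_n.+1] rV_uncons.
Proof.
apply/measurable_fun_pairP; split; first exact: measurable_rV_coord.
apply: measurable_fun_rV => i.
rewrite (_ : (fun _ => _) = (fun x : 'rV[R]_n.+1 => x ord0 (lift ord0 i))).
  exact: measurable_rV_coord.
by apply/funext => x; rewrite /= mxE.
Qed.

Definition lebesgue_rV_succ : set 'rV[R]_n.+1 -> \bar R :=
  pushforward (lebesgue_measure \x m)%E rV_cons.

Let pm : {measure set 'rV[R]_n.+1 -> \bar R} :=
  measure_function_pushforward__canonical__measure_function_Measure
    (lebesgue_measure \x m)%E measurable_rV_cons.

HB.instance Definition _ := isMeasure.Build _ _ _ lebesgue_rV_succ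
  (measure0 pm) (measure_ge0 pm) (@measure_semi_sigma_additive _ _ _ pm).

Let lebesgue_rV_succ_sigma_finite : sigma_finite setT lebesgue_rV_succ.
Proof.
have /sigma_finiteP[F [TF ndF Foo]] := sigma_finiteT (@lebesgue_measure R).
have /sigma_finiteP[G [TG ndG Goo]] := sigma_finiteT m.
exists (fun k => rV_uncons @^-1` (F k `*` G k)).
  apply/seteqP; split => // x _.
  have [i _ Fi] : (\bigcup_i F i) (rV_uncons x).1 by rewrite -TF.
  have [j _ Gj] : (\bigcup_i G i) (rV_uncons x).2 by rewrite -TG.
  exists (maxn i j) => //; split.
    by move: Fi; exact/subsetPset/ndF/leq_maxl.
  by move: Gj; exact/subsetPset/ndG/leq_maxr.
move=> k; have [mF Fk] := Foo k; have [mG Gk] := Goo k; split.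
  by rewrite -[X in measurable X]setTI; apply: measurable_rV_uncons => //;
    exact: measurableX.
rewrite /lebesgue_rV_succ /pushforward -comp_preimage.
rewrite (_ : rV_uncons \o rV_cons = id); last exact/funext/rV_consK.
by rewrite preimage_id product_measure1E// lte_mul_pinfty// ge0_fin_numE.
Qed.

HB.instance Definition _ := Measure_isSigmaFinite.Build _ _ _ lebesgue_rV_succ
  lebesgue_rV_succ_sigma_finite.

End lebesgue_rV_succ.

Fixpoint lebesgue_rV {R : realType} (n : nat) :
    {sigma_finite_measure set 'rV[R]_n -> \bar R} :=
  match n with
  | 0 => \d_(0 : 'rV[R]_0)
  | n'.+1 => lebesgue_rV_succ (lebesgue_rV n')
  end.

Section L2.
Context {R : realType} (n : nat) (Omega : set 'rV[R]_n).
Local Notation fct := ('rV[R]_n -> R[i]).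
Local Notation mu := (lebesgue_rV n).
Implicit Types f g : fct.

Definition cmeasurable f :=
  measurable_fun Omega (fun x => complex.Re (f x)) /\
  measurable_fun Omega (fun x => complex.Im (f x)).

Definition Lp_norm (p : \bar R) f : \bar R :=
  Lnorm mu p (fun x => (normc (f x) * \1_Omega x)%:E).

Definition L2 : set fct := [set f | cmeasurable f /\ (Lp_norm 2%:E f < +oo)%E].
Definition Linfty : set fct :=
  [set f | cmeasurable f /\ (Lp_norm +oo%E f < +oo)%E].

Definition L2norm f : R := fine (Lp_norm 2%:E f).
Definition Linfty_norm f : R := fine (Lp_norm +oo%E f).

Definition cintegral f : R[i] :=
  (\int[mu]_(x in Omega) complex.Re (f x)) +i*
  (\int[mu]_(x in Omega) complex.Im (f x)).

Definition inner f g : R[i] := cintegral (fun x => f x * conjc (g x)).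

Definition ae_eq_on f g := {ae mu, forall x, Omega x -> f x = g x}.

Definition lin_comb (I : choiceType) (A : {fset I}) (c : I -> R[i])
  (u : I -> fct) : fct := fun x => \sum_(xi <- A) c xi * u xi x.

Definition riesz_basis (I : choiceType) (u : I -> fct) :=
  [/\ forall xi, L2 (u xi),
      forall f, L2 f -> forall e : R, 0 < e -> exists A c,
        L2norm (fun x => f x - lin_comb A c u x) < e &
      exists a b : R, [/\ 0 < a, 0 < b & forall (A : {fset I}) c,
        a * \sum_(xi <- A) normc (c xi) ^+ 2
          <= L2norm (lin_comb A c u) ^+ 2
          <= b * \sum_(xi <- A) normc (c xi) ^+ 2]].

(* Elements of L2 are represented by functions; [L2_linear] makes the domain
   and the action compatible with almost everywhere equality.  The values of
   [act] outside [dom] are irrelevant. *)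
Record operator := Operator { dom : set fct; act :> fct -> fct }.
Implicit Types L : operator.

Definition L2_linear L :=
  [/\ dom L `<=` L2,
      forall f, dom L f -> L2 (L f),
      dom L (fun=> 0),
      forall c f g, dom L f -> dom L g -> dom L (fun x => c * f x + g x) /\
        ae_eq_on (L (fun x => c * f x + g x)) (fun x => c * L f x + L g x) &
      forall f g, L2 g -> dom L f -> ae_eq_on f g ->
        dom L g /\ ae_eq_on (L f) (L g)].

Definition is_adjoint L Ls :=
  dom Ls = [set g | L2 g /\
    exists h, L2 h /\ forall f, dom L f -> inner (L f) g = inner f h] /\
  forall g, dom Ls g -> L2 (Ls g) /\
    forall f, dom L f -> inner (L f) g = inner f (Ls g).

Definition eigenfunction L (z : R[i]) f :=
  dom L f /\ ae_eq_on (L f) (fun x => z * f x).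

Definition resolvent_set L : set R[i] :=
  [set z | exists M : R, forall g, L2 g -> exists f,
    [/\ dom L f, ae_eq_on (fun x => L f x - z * f x) g,
        forall f', dom L f' -> ae_eq_on (fun x => L f' x - z * f' x) g ->
          ae_eq_on f' f &
        L2norm f <= M * L2norm g]].

(* The spectrum is {lam xi}, it consists of isolated eigenvalues of finite
   multiplicity, and each eigenvalue z is listed as many times as its
   multiplicity: the u xi with lam xi = z span ker (L - z). *)
Definition discrete_spectrum L (I : choiceType) (lam : I -> R[i])
    (u : I -> fct) :=
  [/\ ~` resolvent_set L = range lam,
      forall xi, exists2 e : R, 0 < e & forall eta, lam eta != lam xi ->
        e <= normc (lam eta - lam xi),
      forall xi, finite_set [set eta | lam eta = lam xi] &
      forall xi f, eigenfunction L (lam xi) f -> exists A c,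
        (forall eta, eta \in A -> lam eta = lam xi) /\
        ae_eq_on f (lin_comb A c u)].

Definition dom_infty L : set fct := [set f | forall k, dom L (iter k L f)].

Definition graph_norm L k f : R :=
  \big[Num.max/0]_(j < k.+1) L2norm (iter j L f).

Definition dom_infty_complete L := forall F : nat -> fct,
  (forall i, dom_infty L (F i)) ->
  (forall k (e : R), 0 < e -> exists N, forall i j, (N <= i)%N -> (N <= j)%N ->
     graph_norm L k (fun x => F i x - F j x) < e) ->
  exists2 f, dom_infty L f & forall k,
    graph_norm L k (fun x => F i x - f x) @[i --> \oo] --> (0 : R).

Definition unit_vec (i : 'I_n) : 'rV[R]_n := delta_mx ord0 i.

Definition partial (i : 'I_n) f : fct := fun x =>
  ('D_(unit_vec i) (fun y => complex.Re (f y)) x) +i*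
  ('D_(unit_vec i) (fun y => complex.Im (f y)) x).

Definition smooth_on (D : set 'rV[R]_n) f :=
  forall (s : seq 'I_n) x, D x -> let g := foldr partial f s in
    [/\ {for x, continuous (fun y => complex.Re (g y) : R)},
        {for x, continuous (fun y => complex.Im (g y) : R)} &
        forall i, derivable (fun y => complex.Re (g y)) x (unit_vec i) /\
                  derivable (fun y => complex.Im (g y)) x (unit_vec i)].

Definition test_function f := smooth_on setT f /\
  exists K, [/\ compact K, K `<=` Omega & forall x, ~ K x -> f x = 0].

(* A multi-index of length at most m has all its entries at most m. *)
Definition multi_index m := {ffun 'I_n -> 'I_m.+1}.
Definition mlength m (alpha : multi_index m) : nat := \sum_i alpha i.
Definition multi_partial m (alpha : multi_index m) f : fct :=
  foldr (fun i g => iter (alpha i) (partial i) g) f (enum 'I_n).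

(* L f = \sum_(|alpha| <= m) a_alpha d^alpha f for f in the domain, the
   derivatives being taken in the sense of distributions on Omega (transposed
   onto the test function).  The linear boundary conditions are encoded in the
   domain, an arbitrary linear subspace by [L2_linear]. *)
Definition differential_operator m L := exists a : multi_index m -> fct,
  [/\ forall alpha, smooth_on Omega (a alpha),
      exists alpha x, [/\ mlength alpha = m, Omega x & a alpha x != 0] &
      forall f phi, dom L f -> test_function phi ->
        cintegral (fun x => L f x * phi x) =
        \sum_(alpha : multi_index m | (mlength alpha <= m)%N)
          (-1) ^+ mlength alpha * cintegral (fun x =>
            f x * multi_partial alpha (fun y => a alpha y * phi y) x)].

End L2.

Definition euclid_norm {R : realType} K (j : 'rV[int]_K) : R :=
  Num.sqrt (\sum_i ((j ord0 i)%:~R) ^+ 2).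

Section sequence_spaces.
Context {R : realType} (I : choiceType).
Implicit Types (a b : I -> R[i]) (p q : \bar R).

Definition japanese m (lam : I -> R[i]) (xi : I) : R :=
  (1 + normc (lam xi) ^+ 2) `^ (2 * m%:R)^-1.

(* S'(I), where [jap] is xi |-> <xi> *)
Definition tempered (jap : I -> R) : set (I -> R[i]) :=
  [set a | exists C M : R, forall xi, normc (a xi) <= C * jap xi `^ M].

(* In l^p(L), wu xi and wv xi are the sup norms of u xi and v xi; in l^p(L^* )
   they are exchanged.  The maximum with 0 only matters for empty I. *)
Definition lp_norm (wu wv : I -> R) p a : \bar R :=
  match p with
  | r%:E =>
      let w := if r <= 2 then wu else wv in
      poweR (\esum_(xi in [set: I])
        (normc (a xi) `^ r * w xi `^ (2 - r))%:E)%E r^-1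
  | +oo%E => Order.max 0%E
      (ereal_sup (range (fun xi => (normc (a xi) * (wv xi)^-1)%:E)))
  | -oo%E => 0%E
  end.

Definition lp_space (jap wu wv : I -> R) p : set (I -> R[i]) :=
  [set a | tempered jap a /\ (lp_norm wu wv p a < +oo)%E].

(* A normed space of sequences is given by its set of elements X and its norm
   N; a functional on X is a total function whose values outside X are
   irrelevant. *)
Definition dual_space (X : set (I -> R[i])) (N : (I -> R[i]) -> \bar R) :
    set ((I -> R[i]) -> R[i]) :=
  [set F | (forall c a b, X a -> X b ->
              F (fun xi => c * a xi + b xi) = c * F a + F b) /\
           exists M : R, forall a, X a ->
              ((normc (F a))%:E <= M%:E * N a)%E].

Definition dual_norm (X : set (I -> R[i])) (N : (I -> R[i]) -> \bar R)
    (F : (I -> R[i]) -> R[i]) : \bar R :=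
  ereal_sup [set (normc (F a))%:E | a in [set a | X a /\ (N a <= 1)%E]].

(* F a = \sum_xi a xi * b xi on X, as an unconditionally convergent sum *)
Definition represents (X : set (I -> R[i])) b (F : (I -> R[i]) -> R[i]) :=
  forall a, X a ->
    normc (partial_sum (fun xi => a xi * b xi) A - F a) @[A --> totally]
      --> (0 : R).

(* (X, N)' = (Y, N'): the bilinear pairing identifies Y isometrically with the
   dual of X. *)
Definition dual_identified (X : set (I -> R[i])) N (Y : set (I -> R[i])) N' :=
  (forall b, Y b -> exists F,
     [/\ dual_space X N F, represents X b F & dual_norm X N F = N' b]) /\
  (forall F, dual_space X N F -> exists! b, Y b /\ represents X b F).

End sequence_spaces.

(* Main.v *)
Require Import Defs.
From mathcomp Require Import all_boot all_order all_algebra finmap complex.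
From mathcomp Require Import all_classical all_reals all_analysis.
From mathcomp Require Import measurable_realfun ess_sup_inf.
From mathcomp.analysis Require Import showcase.summability.
From mathcomp Require Import ring lra.

(** All the spaces involved are weighted l^p spaces.  Let w be the sup norms of
    the u_xi when p <= 2 and those of the v_xi when p > 2.  Then
    |a|^p w^(2 - p) = (|a| alpha)^p with alpha = w^((2 - p)/p), so that l^p(L)
    is l^p with weight alpha ([lp_norm_wnorm]).  Passing from L to L^* exchanges
    the u_xi and the v_xi, and passing from p to p' exchanges the two ranges of
    exponents; hence l^p'(L^* ) is built on the same w, and since
    (2 - p')/p' = - (2 - p)/p its weight is 1/alpha ([lp_norm_dual_wnorm]).
    The theorem is therefore the classical duality between l^p with weight
    alpha and l^p' with weight 1/alpha ([weighted_dual_identified]).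

    That duality is proved in the usual way.  Hoelder's inequality shows that
    the pairing with b converges unconditionally and bounds its norm
    ([wnorm_hoelder]); the equality case of Hoelder's inequality, tested on
    finitely supported sequences, shows that the bound is sharp
    ([wnorm_dual_le]).  Conversely a bounded functional is the pairing with its
    values on the unit sequences, because for p < oo the finitely supported
    sequences are dense ([wnorm_trunc_compl]).

    The spaces consist of tempered sequences, so the sequence of values of the
    functional on the unit sequences has to be tempered as well.  As it is
    bounded by a multiple of alpha, it is enough that alpha be tempered.  For
    p < 2 this follows from the temperedness of the sup norms.  For p >= 2 the
    exponent of w in alpha is nonpositive, and what is needed is that the sup
    norms be bounded away from 0: a Riesz basis is bounded below in L^2, and on
    a bounded domain the L^2 norm is at most a constant times the sup norm
    ([riesz_basis_Linfty_norm_lower_bound]). *)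

Set Implicit Arguments.
Unset Strict Implicit.
Unset Printing Implicit Defensive.
Import Order.TTheory GRing.Theory Num.Theory ComplexField ComplexField.Normc.
Import numFieldNormedType.Exports HBNNSimple.
Local Open Scope classical_set_scope.
Local Open Scope ring_scope.
Local Open Scope complex_scope.

#[local] Existing Instance totally_filter.

(** * Modulus of complex numbers *)

Section complex_modulus.
Context {R : realType}.
Implicit Types z : R[i].

Lemma normc_ge0 z : 0 <= normc z.
Proof. by case: z => a b; exact: sqrtr_ge0. Qed.

Lemma normcD z1 z2 : normc (z1 + z2) <= normc z1 + normc z2.
Proof. exact: le_normcD. Qed.

Lemma normc_opp z : normc (- z) = normc z.
Proof. exact: normcN. Qed.

Lemma normc_sum (T : Type) (r : seq T) (F : T -> R[i]) :
  normc (\sum_(i <- r) F i) <= \sum_(i <- r) normc (F i).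
Proof.
elim/big_rec2: _ => [|i y z _ le_zy]; first by rewrite normc0.
by rewrite (le_trans (normcD _ _))// lerD2l.
Qed.

Lemma normcR (a : R) : normc a%:C = `|a|.
Proof. by rewrite /normc/= expr0n/= addr0 sqrtr_sqr. Qed.

Lemma ler_Re_normc z : `|complex.Re z| <= normc z.
Proof. by case: z => a b /=; rewrite -sqrtr_sqr ler_wsqrtr// lerDl sqr_ge0. Qed.

Lemma ler_Im_normc z : `|complex.Im z| <= normc z.
Proof. by case: z => a b /=; rewrite -sqrtr_sqr ler_wsqrtr// lerDr sqr_ge0. Qed.

Lemma ler_normc_ReIm z : normc z <= `|complex.Re z| + `|complex.Im z|.
Proof.
case: z => a b /=; rewrite -[leRHS]ger0_norm ?addr_ge0// -sqrtr_sqr ler_wsqrtr//.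
by rewrite sqrrD !real_normK ?num_real// lerD2r lerDl mulrn_wge0// mulr_ge0.
Qed.

Lemma normc_conj z : normc (conjc z) = normc z.
Proof. by case: z => a b /=; rewrite sqrrN. Qed.

Lemma normc_eq0 z : (normc z == 0) = (z == 0).
Proof. by apply/eqP/eqP => [/eq0_normc//|->]; rewrite normc0. Qed.

Lemma conjc_mul z : conjc z * z = (normc z ^+ 2)%:C.
Proof.
case: z => a b; rewrite /= sqr_sqrtr ?addr_ge0 ?sqr_ge0//.
by simpc; rewrite !expr2; congr (_ +i* _); ring.
Qed.

End complex_modulus.

(** * Sums of nonnegative families *)

Section finite_sums.
Context {R : realType} {I : choiceType}.
Implicit Types (s t x y : I -> R) (A B : {fset I}).

Lemma ler_fsum_subset s A B : (forall xi, 0 <= s xi) -> (A `<=` B)%fset ->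
  \sum_(xi <- A) s xi <= \sum_(xi <- B) s xi.
Proof.
move=> s0 AB; rewrite (big_fsetID _ (fun xi => xi \in A) B)/=.
have -> : [fset xi in B | xi \in A]%fset = A.
  by apply/fsetP => xi; rewrite !inE/= andbC; case: (boolP (xi \in A)) => // /(fsubsetP AB).
by rewrite lerDl sumr_ge0.
Qed.

Lemma ler_fsum_supp s A B : (forall xi, 0 <= s xi) ->
  (forall xi, xi \notin A -> s xi = 0) ->
  \sum_(xi <- B) s xi <= \sum_(xi <- A) s xi.
Proof.
move=> s0 sA; rewrite (le_trans (ler_fsum_subset s0 (fsubsetUr A B)))//.
by rewrite -(big_fset_incl _ (fsubsetUl A B))// => xi _ /sA.
Qed.

Lemma esum_le_finite s (M : R) :
  (\esum_(xi in [set: I]) (s xi)%:E <= M%:E)%E <->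
  (forall A, \sum_(xi <- A) s xi <= M).
Proof.
split=> [sM A|sM].
  rewrite -lee_fin (le_trans _ sM)// -sumEFin; apply: esum_ge.
  by exists [set` A]; [split|rewrite -fsbig_seq].
apply: ge_ereal_sup => _ [X [finX _] <-].
by rewrite fsbig_finite//= sumEFin lee_fin.
Qed.

(** The tails are cut by setting the terms in [B] to 0, which is the form in
    which the truncations of a sequence produce them. *)
Lemma esum_tail s (e : R) : (forall xi, 0 <= s xi) ->
  (\esum_(xi in [set: I]) (s xi)%:E < +oo)%E -> 0 < e ->
  exists A, forall B C : {fset I}, (A `<=` B)%fset ->
    \sum_(xi <- C) (if xi \in B then 0 else s xi) <= e.
Proof.
move=> s0 soo e0.
have soo0 : (0 <= \esum_(xi in [set: I]) (s xi)%:E)%E.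
  by apply: esum_ge0 => xi _; rewrite lee_fin.
set S := esum _ _ in soo soo0.
have SE : S = (fine S)%:E by rewrite fineK// ge0_fin_numE.
have /ereal_sup_gt[_ [X [finX _] <-]] : ((fine S - e)%:E < S)%E.
  by rewrite [ltRHS]SE lte_fin ltrBlDr ltrDl.
rewrite fsbig_finite//= sumEFin lte_fin => XS.
exists (fset_set X) => B C XB.
have /esum_le_finite/(_ (B `|` C)%fset) : (S <= (fine S)%:E)%E by rewrite -SE.
(* Split the sum over B and C into B and C minus B: the first part exceeds
   S - e, the whole is at most S. *)
rewrite (big_fsetID _ (fun xi => xi \in B) (B `|` C)%fset)/=.
have -> : [fset xi in (B `|` C)%fset | xi \in B]%fset = B.
  by apply/fsetP => xi; rewrite !inE/=; case: (xi \in B); rewrite ?andbF.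
rewrite (_ : \sum_(xi <- C) _ = \sum_(xi <- [fset xi in (B `|` C)%fset | xi \notin B]%fset) s xi).
  by have := ler_fsum_subset s0 XB; lra.
rewrite [LHS](big_fsetID _ (fun xi => xi \in B) C)/= big1_seq ?add0r; last first.
  by move=> xi /=; rewrite !inE/= => /andP[_ ->].
rewrite big_seq_cond; under eq_bigr => xi.
  rewrite !inE/= andbT => /andP[_ /negPf->].
over.
rewrite -big_seq_cond; apply: eq_fbigl => xi; rewrite !inE/=.
by case: (xi \in B); rewrite ?andbF.
Qed.

End finite_sums.

(** * Unconditional sums *)

Section unconditional_sums.
Context {R : realType} {I : choiceType}.

Lemma partial_sumE (V : zmodType) (x : I -> V) (A : {fset I}) :
  partial_sum x A = \sum_(xi <- A) x xi.
Proof. by rewrite /partial_sum [RHS]big_seq_fsetE. Qed.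

Lemma nonneg_partial_sum_cvg (s : I -> R) (M : R) :
  (forall xi, 0 <= s xi) -> (forall A : {fset I}, \sum_(xi <- A) s xi <= M) ->
  exists l : R, partial_sum s @ totally --> l.
Proof.
move=> s0 sM; pose E := range (fun A : {fset I} => \sum_(xi <- A) s xi).
have supE : has_sup E.
  by split; [exists (\sum_(xi <- fset0) s xi), fset0|exists M => _ [A _ <-]].
exists (sup E); apply/cvgrPdist_le => e e0.
have [_ [A _ <-] supA] := sup_adherent e0 supE.
exists A => // B /= AB; rewrite partial_sumE ger0_norm ?subr_ge0.
  by have := ler_fsum_subset s0 AB; lra.
by apply: sup_upper_bound => //; exists B.
Qed.

(** Reduction to nonnegative families by x = (x + |x|) - |x|. *)
Lemma real_partial_sum_cvg (x : I -> R) (M : R) :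
  (forall A : {fset I}, \sum_(xi <- A) `|x xi| <= M) ->
  exists l : R, partial_sum x @ totally --> l.
Proof.
move=> xM.
have [||l1 h1] := @nonneg_partial_sum_cvg (fun xi => x xi + `|x xi|) (M + M).
- by move=> xi; have := ler_norm (- x xi); rewrite normrN => ?; lra.
- by move=> A; rewrite big_split/= lerD// (le_trans _ (xM A))// ler_sum// => xi _; exact: ler_norm.
have [//|l2 h2] := @nonneg_partial_sum_cvg (fun xi => `|x xi|) M _ xM.
exists (l1 - l2); rewrite (_ : partial_sum x =
  partial_sum (fun xi => x xi + `|x xi|) \- partial_sum (fun xi => `|x xi|)).
  exact: cvgB.
by apply/funext => A; rewrite /= !partial_sumE big_split/= addrK.
Qed.

Definition has_sum (x : I -> R[i]) (l : R[i]) :=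
  normc (partial_sum x A - l) @[A --> totally] --> (0 : R).

Lemma has_sumP (x : I -> R[i]) (l : R[i]) : has_sum x l <->
  forall e : R, 0 < e -> exists A : {fset I}, forall B : {fset I},
    (A `<=` B)%fset -> normc (\sum_(xi <- B) x xi - l) <= e.
Proof.
split=> [/cvgr0Pnorm_le xl e e0|xl].
  have [A _ Ae] := xl e e0; exists A => B AB.
  by have := Ae B AB; rewrite /= partial_sumE ger0_norm// normc_ge0.
apply/cvgr0Pnorm_le => e e0; have [A Ae] := xl e e0; exists A => // B AB /=.
by rewrite partial_sumE ger0_norm ?normc_ge0// Ae.
Qed.

Lemma abs_summable_has_sum (x : I -> R[i]) (M : R) :
  (forall A : {fset I}, \sum_(xi <- A) normc (x xi) <= M) ->
  exists l, has_sum x l.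
Proof.
move=> xM.
have [A|l1 /cvgrPdist_le h1] := @real_partial_sum_cvg (fun xi => complex.Re (x xi)) M.
  by rewrite (le_trans _ (xM A))// ler_sum// => xi _; exact: ler_Re_normc.
have [A|l2 /cvgrPdist_le h2] := @real_partial_sum_cvg (fun xi => complex.Im (x xi)) M.
  by rewrite (le_trans _ (xM A))// ler_sum// => xi _; exact: ler_Im_normc.
exists (l1 +i* l2); apply/has_sumP => e e0.
have e20 : 0 < e / 2 by rewrite divr_gt0.
have [A1 _ A1e] := h1 _ e20; have [A2 _ A2e] := h2 _ e20.
exists (A1 `|` A2)%fset => B; rewrite fsubUset => /andP[A1B A2B].
have := A1e B A1B; have := A2e B A2B; rewrite /= !partial_sumE => b2 b1.
have -> : \sum_(xi <- B) x xi = (\sum_(xi <- B) complex.Re (x xi)) +i*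
    (\sum_(xi <- B) complex.Im (x xi)).
  elim/big_rec3: _ => [//|xi a b c _ ->].
  by case: (x xi) => ? ?; simpc.
rewrite (le_trans (ler_normc_ReIm _))//= distrC [X in _ + X]distrC.
by rewrite [leRHS](splitr e) lerD.
Qed.

Lemma has_sum_unique (x : I -> R[i]) l1 l2 : has_sum x l1 -> has_sum x l2 -> l1 = l2.
Proof.
move=> /has_sumP h1 /has_sumP h2; apply/eqP; rewrite -subr_eq0 -normc_eq0.
rewrite eq_le normc_ge0 andbT; apply/ler_addgt0Pr => e e0; rewrite add0r.
have e20 : 0 < e / 2 by rewrite divr_gt0.
have [A1 A1e] := h1 _ e20; have [A2 A2e] := h2 _ e20.
have := A1e _ (fsubsetUl A1 A2); have := A2e _ (fsubsetUr A1 A2).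
set S := \sum_(_ <- _) _ => b2 b1.
have -> : l1 - l2 = (S - l2) + - (S - l1) by ring.
by rewrite (le_trans (normcD _ _))// normc_opp [leRHS](splitr e) lerD.
Qed.

Lemma has_sum_lin (c : R[i]) (x y : I -> R[i]) lx ly : has_sum x lx -> has_sum y ly ->
  has_sum (fun xi => c * x xi + y xi) (c * lx + ly).
Proof.
move=> /has_sumP h1 /has_sumP h2; apply/has_sumP => e e0.
have e10 : 0 < e / 2 / (normc c + 1) by rewrite !divr_gt0// ltr_wpDl ?normc_ge0.
have e20 : 0 < e / 2 by rewrite divr_gt0.
have [A1 A1e] := h1 _ e10; have [A2 A2e] := h2 _ e20.
exists (A1 `|` A2)%fset => B; rewrite fsubUset => /andP[A1B A2B].
have := A1e B A1B; have := A2e B A2B; rewrite big_split/= -mulr_sumr.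
set X := \sum_(_ <- _) _; set Y := \sum_(_ <- _) _ => b2 b1.
have -> : c * Y + X - (c * lx + ly) = c * (Y - lx) + (X - ly) by ring.
rewrite (le_trans (normcD _ _))// [leRHS](splitr e) lerD// normcM.
rewrite ler_pdivlMr ?ltr_wpDl ?normc_ge0// in b1.
by rewrite (le_trans _ b1)// mulrC ler_wpM2l ?normc_ge0// lerDl.
Qed.

Lemma has_sum_finite (x : I -> R[i]) (A : {fset I}) :
  (forall xi, xi \notin A -> x xi = 0) -> has_sum x (\sum_(xi <- A) x xi).
Proof.
move=> xA; apply/has_sumP => e e0; exists A => B AB.
by rewrite -(big_fset_incl _ AB) ?subrr ?normc0 ?ltW// => xi _; exact: xA.
Qed.

(** The bound is asked on the sums of moduli because that is what Hoelder's
    inequality provides. *)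
Lemma has_sum_norm_le (x : I -> R[i]) l (M : R) :
  (forall A : {fset I}, \sum_(xi <- A) normc (x xi) <= M) ->
  has_sum x l -> normc l <= M.
Proof.
move=> xM /has_sumP xl; apply/ler_addgt0Pr => e e0; have [A Ae] := xl e e0.
have := Ae A (fsubset_refl A); set S := \sum_(_ <- _) _ => b.
have -> : l = S + - (S - l) by ring.
rewrite (le_trans (normcD _ _))// normc_opp lerD//.
by rewrite (le_trans (normc_sum _ _)).
Qed.

End unconditional_sums.

(** * Hoelder's inequality for finite sums *)

Section hoelder_finite_sums.
Context {R : realType} {I : choiceType}.
Implicit Types (x y : I -> R) (A : {fset I}).

Lemma powRV (a r : R) : 0 <= a -> a^-1 `^ r = (a `^ r)^-1.
Proof. by move=> a0; rewrite -powR_inv1// -powRrM mulN1r powRN. Qed.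

Lemma fsum_powR_eq0 x A (p : R) : 0 < p ->
  \sum_(xi <- A) x xi `^ p <= 0 -> forall xi, xi \in A -> x xi = 0.
Proof.
move=> p0; rewrite le_eqVlt ltNge sumr_ge0 => [|xi _]; last exact: powR_ge0.
rewrite orbF psumr_eq0 => [/allP xA xi /xA/= /eqP /powR_eq0_eq0//|xi _].
exact: powR_ge0.
Qed.

(** After division by X and Y this is Young's inequality summed over A; the
    cases X = 0 and Y = 0, where one cannot divide, force one factor to
    vanish on A. *)
Lemma hoelder_fsum x y A (p q X Y : R) :
  (forall xi, 0 <= x xi) -> (forall xi, 0 <= y xi) ->
  0 < p -> 0 < q -> p^-1 + q^-1 = 1 -> 0 <= X -> 0 <= Y ->
  \sum_(xi <- A) x xi `^ p <= X `^ p -> \sum_(xi <- A) y xi `^ q <= Y `^ q ->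
  \sum_(xi <- A) x xi * y xi <= X * Y.
Proof.
move=> x0 y0 p0 q0 pq; rewrite le_eqVlt => /predU1P[<- _|X0].
  rewrite powR0 ?gt_eqF// => /(fsum_powR_eq0 p0) xA _.
  by rewrite big1_seq ?mul0r// => xi /= /xA ->; rewrite mul0r.
rewrite le_eqVlt => /predU1P[<- _|Y0].
  rewrite powR0 ?gt_eqF// => /(fsum_powR_eq0 q0) yA.
  by rewrite big1_seq ?mulr0// => xi /= /yA ->; rewrite mulr0.
move=> xX yY.
have X'0 : 0 < X `^ p by exact: powR_gt0.
have Y'0 : 0 < Y `^ q by exact: powR_gt0.
rewrite -[leRHS]mul1r -ler_pdivrMr ?mulr_gt0// mulr_suml.
apply: (@le_trans _ _ (\sum_(xi <- A)
    (x xi `^ p * ((X `^ p)^-1 / p) + y xi `^ q * ((Y `^ q)^-1 / q)))).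
  apply: ler_sum => xi _; rewrite !mulrA.
  rewrite -[(X `^ p)^-1]powRV ?(ltW X0)// -[(Y `^ q)^-1]powRV ?(ltW Y0)//.
  rewrite -!powRM ?invr_ge0 ?(ltW X0) ?(ltW Y0)//.
  rewrite (_ : _ / _ = (x xi / X) * (y xi / Y)); last first.
    by rewrite invfM; ring.
  by apply: conjugate_powR => //; rewrite divr_ge0// ltW.
rewrite big_split/= -!mulr_suml -pq lerD// mulrA ler_piMl ?invr_ge0 ?(ltW p0) ?(ltW q0)//.
  by rewrite ler_pdivrMr// mul1r.
by rewrite ler_pdivrMr// mul1r.
Qed.

(** Hoelder's inequality is an equality for x proportional to y^(q - 1): with
    S the sum of the y^q, the choice x = S^(-1/p) y^(q - 1) has l^p norm 1 and
    pairs with y to S^(1/q). *)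
Lemma hoelder_fsum_sharp y A (p q D : R) :
  (forall xi, 0 <= y xi) -> 1 < p -> 1 < q -> p^-1 + q^-1 = 1 -> 0 <= D ->
  (forall x, (forall xi, 0 <= x xi) -> \sum_(xi <- A) x xi `^ p <= 1 ->
    \sum_(xi <- A) x xi * y xi <= D) ->
  \sum_(xi <- A) y xi `^ q <= D `^ q.
Proof.
move=> y0 p1 q1 pq D0 yD; set S := \sum_(xi <- A) _.
have p0 : 0 < p by exact: lt_trans p1.
have q0 : 0 < q by exact: lt_trans q1.
have : 0 <= S by apply: sumr_ge0 => xi _; exact: powR_ge0.
rewrite le_eqVlt => /predU1P[<-|S0]; first exact: powR_ge0.
have qp : (q - 1) * p = q.
  by move: pq => /(congr1 (fun z => z * (p * q))); rewrite mulrDl mulrA mulVf ?gt_eqF// mul1r mulrCA mulVf ?gt_eqF// => ?; lra.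
have := yD (fun xi => S `^ (- p^-1) * y xi `^ (q - 1)).
have -> : \sum_(xi <- A) S `^ (- p^-1) * y xi `^ (q - 1) * y xi = S `^ q^-1.
  under eq_bigr => xi _ do rewrite -mulrA [_ * y xi]mulrC mulr_powRB1//.
  rewrite -mulr_sumr -/S -{2}[S]powRr1 ?(ltW S0)// -powRD ?(gt_eqF S0) ?implybT//.
  by congr (_ `^ _); lra.
move=> SD; have /ge0_ler_powR : S `^ q^-1 <= D.
  apply: SD => [xi|]; first by rewrite mulr_ge0 ?powR_ge0.
  under eq_bigr => xi _ do rewrite powRM ?powR_ge0// -!powRrM qp.
  by rewrite -mulr_sumr -/S mulNr mulVf ?gt_eqF// powR_inv1 ?(ltW S0)// mulVf ?gt_eqF.
move=> /(_ q); rewrite !nnegrE powR_ge0 D0 => /(_ (ltW q0) isT isT).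
by rewrite -powRrM mulVf ?gt_eqF// powRr1// ltW.
Qed.

End hoelder_finite_sums.

(** * Weighted sequence norms *)

Section weighted_norms.
Context {R : realType} {I : choiceType}.
Implicit Types (alpha : I -> R) (a b : I -> R[i]) (A B : {fset I}).

(** The maximum with 0 makes the norm 0, and not -oo, on an empty index set. *)
Definition wnorm alpha (p : \bar R) a : \bar R :=
  match p with
  | r%:E => poweR (\esum_(xi in [set: I]) ((normc (a xi) * alpha xi) `^ r)%:E) r^-1
  | +oo%E => Order.max 0%E
      (ereal_sup (range (fun xi => (normc (a xi) * alpha xi)%:E)))
  | -oo%E => 0%E
  end.

Lemma wnorm_ge0 alpha p a : (0 <= wnorm alpha p a)%E.
Proof. by case: p => [r||]//=; [exact: poweR_ge0|rewrite le_max lexx]. Qed.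

Lemma wnorm_fineK alpha p a : (wnorm alpha p a < +oo)%E ->
  wnorm alpha p a = (fine (wnorm alpha p a))%:E.
Proof. by move=> aoo; rewrite fineK// ge0_fin_numE// wnorm_ge0. Qed.

Lemma wnorm_le_finite alpha (p M : R) a : 0 < p -> 0 <= M ->
  (wnorm alpha p%:E a <= M%:E)%E <->
  (forall A, \sum_(xi <- A) (normc (a xi) * alpha xi) `^ p <= M `^ p).
Proof.
move=> p0 M0; rewrite -esum_le_finite /=; set S := esum _ _.
have S0 : (0 <= S)%E by apply: esum_ge0 => xi _; rewrite lee_fin powR_ge0.
have in0y (z : \bar R) : (0 <= z)%E -> z \in `[0%E, +oo%E].
  by move=> z0; rewrite in_itv/= z0 leey.
split=> [SM|SM].
  have : (poweR (poweR S p^-1) p <= poweR M%:E p)%E.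
    by apply: gt0_ler_poweR (ltW p0) _ _ _ _ SM; apply: in0y; rewrite ?poweR_ge0// lee_fin.
  by rewrite -poweRrM mulVf ?gt_eqF// poweRe1.
have : (poweR S p^-1 <= poweR (M `^ p)%:E p^-1)%E.
  apply: gt0_ler_poweR _ _ _ _ _ SM; first by rewrite invr_ge0 ltW.
    exact: in0y.
  by apply: in0y; rewrite lee_fin powR_ge0.
by rewrite poweR_EFin -powRrM mulfV ?gt_eqF// powRr1.
Qed.

Lemma wnorm_le_sup alpha (M : R) a : 0 <= M ->
  (wnorm alpha +oo%E a <= M%:E)%E <->
  (forall xi, normc (a xi) * alpha xi <= M).
Proof.
move=> M0; rewrite /wnorm ge_max lee_fin M0/=; split=> [aM xi|aM].
  by rewrite -lee_fin (le_trans _ aM)//; apply: ereal_sup_ubound; exists xi.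
by apply: ge_ereal_sup => _ [xi _ <-]; rewrite lee_fin.
Qed.

Lemma le_wnorm alpha (p : R) a b : (forall xi, 0 < alpha xi) -> 0 < p ->
  (forall xi, normc (b xi) <= normc (a xi)) ->
  (wnorm alpha p%:E b <= wnorm alpha p%:E a)%E.
Proof.
move=> alpha0 p0 ba; have := wnorm_ge0 alpha p%:E a.
case E: (wnorm alpha p%:E a) => [M||]//= M0; last by rewrite leey.
have /wnorm_le_finite aM : (wnorm alpha p%:E a <= M%:E)%E by rewrite E.
apply/wnorm_le_finite => // A; rewrite (le_trans _ (aM p0 M0 A))//.
apply: ler_sum => xi _; rewrite ge0_ler_powR ?nnegrE ?(ltW p0)//.
- by rewrite mulr_ge0 ?normc_ge0// ltW.
- by rewrite mulr_ge0 ?normc_ge0// ltW.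
- by rewrite ler_wpM2r// ltW.
Qed.

Lemma wnorm_finite_support alpha (p : R) a A : 0 < p ->
  (forall xi, xi \notin A -> a xi = 0) -> (wnorm alpha p%:E a < +oo)%E.
Proof.
move=> p0 aA; rewrite /wnorm poweR_lty//.
apply: (@le_lt_trans _ _ (\sum_(xi <- A) (normc (a xi) * alpha xi) `^ p)%:E); last exact: ltry.
apply/esum_le_finite => B; apply: ler_fsum_supp => [xi|xi xiA]; first exact: powR_ge0.
by rewrite aA// normc0 mul0r powR0// gt_eqF.
Qed.

Lemma conjugate_exponents (p : R) (q : \bar R) : 1 <= p -> (p%:E^-1 + q^-1 = 1)%E ->
  p = 1 /\ q = +oo%E \/
  exists r : R, [/\ q = r%:E, 1 < p, 1 < r & p^-1 + r^-1 = 1].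
Proof.
move=> p1; have p0 : 0 < p by exact: lt_le_trans p1.
rewrite inver gt_eqF//; case: q => [r||]; last by rewrite inveNy.
- rewrite inver; have [->|r0] := eqVneq r 0; first by [].
  rewrite -EFinD => -[pr]; right; exists r.
  have pV1 : p^-1 <= 1 by rewrite invf_le1.
  have pV0 : 0 < p^-1 by rewrite invr_gt0.
  have rV : 0 < r^-1.
    rewrite lt_neqAle eq_sym invr_eq0 r0/=; lra.
  have p_gt1 : 1 < p by rewrite -invf_lt1//; lra.
  have r_gt0 : 0 < r by rewrite -invr_gt0.
  by split => //; rewrite -(invf_lt1 r_gt0); lra.
- rewrite invey adde0 => -[/(congr1 GRing.inv)]; rewrite invrK invr1 => ->; by left.
Qed.

(** The weights of the two norms cancel in the products of the terms. *)
Lemma wnorm_hoelder alpha (p : R) (q : \bar R) a b (X Y : R) A :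
  (forall xi, 0 < alpha xi) -> 1 <= p -> (p%:E^-1 + q^-1 = 1)%E ->
  0 <= X -> 0 <= Y ->
  (wnorm alpha p%:E a <= X%:E)%E ->
  (wnorm (fun xi => (alpha xi)^-1)%R q b <= Y%:E)%E ->
  \sum_(xi <- A) normc (a xi * b xi) <= X * Y.
Proof.
move=> alpha0 p1 pq X0 Y0; have p0 : 0 < p by exact: lt_le_trans p1.
have split_weight xi : normc (a xi * b xi) =
    (normc (a xi) * alpha xi) * (normc (b xi) * (alpha xi)^-1).
  by rewrite normcM mulrACA mulfV ?gt_eqF// mulr1.
have [[p_eq1 ->]|[r [-> {}p1 r1 pr]]] := conjugate_exponents p1 pq.
  move=> /(wnorm_le_finite _ _ p0 X0)/(_ A) aX /(wnorm_le_sup _ _ Y0) bY.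
  move: aX; rewrite p_eq1 powRr1// => aX.
  apply: (le_trans _ (ler_wpM2r Y0 aX)).
  rewrite mulr_suml; apply: ler_sum => xi _; rewrite split_weight.
  by rewrite powRr1 ?ler_wpM2l// mulr_ge0 ?normc_ge0// ltW.
have r0 : 0 < r by exact: lt_trans r1.
move=> /(wnorm_le_finite _ _ p0 X0)/(_ A) aX /(wnorm_le_finite _ _ r0 Y0)/(_ A) bY.
rewrite (eq_bigr _ (fun xi _ => split_weight xi)).
apply: hoelder_fsum aX bY => // xi.
- by rewrite mulr_ge0 ?normc_ge0// ltW.
- by rewrite mulr_ge0 ?normc_ge0// invr_ge0 ltW.
Qed.

(** Converse of Hoelder's inequality: the norm of b is the supremum of its
    pairings with finitely supported sequences of norm at most 1.  A nonnegative
    x yields a test sequence by dividing by the weight and multiplying by the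
    conjugate phase of b, so that the terms of the pairing become x times
    |b| / alpha; the best x is given by [hoelder_fsum_sharp] when q is finite,
    and by a unit sequence when q = oo. *)
Lemma wnorm_dual_le alpha (p : R) (q : \bar R) b (D : R) :
  (forall xi, 0 < alpha xi) -> 1 <= p -> (p%:E^-1 + q^-1 = 1)%E -> 0 <= D ->
  (forall a A, (forall xi, xi \notin A -> a xi = 0) ->
    (wnorm alpha p%:E a <= 1)%E -> normc (\sum_(xi <- A) a xi * b xi) <= D) ->
  (wnorm (fun xi => (alpha xi)^-1)%R q b <= D%:E)%E.
Proof.
move=> alpha0 p1 pq D0 bD; have p0 : 0 < p by exact: lt_le_trans p1.
have alphaV0 xi : 0 < (alpha xi)^-1 by rewrite invr_gt0.
pose y xi := normc (b xi) * (alpha xi)^-1.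
have y0 xi : 0 <= y xi by rewrite mulr_ge0 ?normc_ge0// ltW.
have yD A (x : I -> R) : (forall xi, 0 <= x xi) ->
    \sum_(xi <- A) x xi `^ p <= 1 -> \sum_(xi <- A) x xi * y xi <= D.
  move=> x0 x1.
  (* Where b vanishes the quotient by |b| is 0, and so is the pairing term. *)
  pose a xi := if xi \in A then
    (x xi / alpha xi / normc (b xi))%:C * conjc (b xi) else 0.
  have aE xi : normc (a xi) * alpha xi <= if xi \in A then x xi else 0.
    rewrite /a; case: ifPn => _; last by rewrite normc0 mul0r.
    have xa0 : 0 <= x xi / alpha xi by rewrite mulr_ge0// ltW.
    rewrite normcM normcR normc_conj ger0_norm ?mulr_ge0 ?invr_ge0 ?normc_ge0//; last exact: ltW.
    have [->|b0] := eqVneq (normc (b xi)) 0; first by rewrite mulr0 mul0r.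
    by rewrite divfK// divfK// gt_eqF.
  have abE : \sum_(xi <- A) a xi * b xi = (\sum_(xi <- A) x xi * y xi)%:C.
    rewrite rmorph_sum/= big_seq [RHS]big_seq; apply: eq_bigr => xi xiA.
    rewrite /a xiA -mulrA conjc_mul -rmorphM/=; congr (_%:C).
    rewrite /y; have [->|b0] := eqVneq (normc (b xi)) 0; first by rewrite expr0n/=; ring.
    by field; rewrite b0 gt_eqF.
  have a1 : (wnorm alpha p%:E a <= 1)%E.
    apply/wnorm_le_finite => // B; rewrite powR1.
    apply: (le_trans _ x1); rewrite (le_trans (ler_fsum_supp (A := A) _ _ _))//.
    - by move=> xi; exact: powR_ge0.
    - by move=> xi /negPf xiA; rewrite /a xiA normc0 mul0r powR0// gt_eqF.
    - rewrite big_seq [leRHS]big_seq; apply: ler_sum => xi xiA.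
      have := aE xi; rewrite xiA => aEx.
      rewrite ge0_ler_powR ?nnegrE ?(ltW p0)// mulr_ge0 ?normc_ge0// ltW//.
  have /(_ _) := bD a A _ a1; rewrite abE normcR => H.
  by rewrite (le_trans (ler_norm _))// H// => xi /negPf xiA; rewrite /a xiA.
have [[p_eq1 ->]|[r [-> {}p1 r1 pr]]] := conjugate_exponents p1 pq; last first.
  have r0 : 0 < r by exact: lt_trans r1.
  by apply/wnorm_le_finite => // A; exact: (@hoelder_fsum_sharp _ _ _ _ p) (yD A).
apply/wnorm_le_sup => // xi.
have := yD [fset xi]%fset (fun=> 1); rewrite !big_seq_fset1 powR1 mul1r; exact.
Qed.

End weighted_norms.

(** * Duality of weighted spaces of tempered sequences *)

Section weighted_duality.
Context {R : realType} {I : choiceType}.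
Variables (jap alpha : I -> R) (p : R) (q : \bar R).
Hypotheses (alpha_gt0 : forall xi, 0 < alpha xi)
  (alpha_tempered : exists C M : R, forall xi, alpha xi <= C * jap xi `^ M)
  (p_ge1 : 1 <= p) (pq : (p%:E^-1 + q^-1 = 1)%E).
Implicit Types (a b : I -> R[i]) (A B : {fset I}).

Definition wspace beta r : set (I -> R[i]) :=
  [set a | tempered jap a /\ (wnorm beta r a < +oo)%E].

Local Notation N := (wnorm alpha p%:E).
Local Notation X := (wspace alpha p%:E).
Local Notation N' := (wnorm (fun xi => (alpha xi)^-1)%R q).
Local Notation Y := (wspace (fun xi => (alpha xi)^-1)%R q).

Let p_gt0 : 0 < p. Proof. exact: lt_le_trans p_ge1. Qed.

Definition unit_seq (xi eta : I) : R[i] := (eta == xi)%:R.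

Definition trunc A a : I -> R[i] := fun xi => if xi \in A then a xi else 0.

Lemma wspace_sub a b : (forall xi, normc (b xi) <= normc (a xi)) -> X a -> X b.
Proof.
move=> ba [[C [M aC]] aoo]; split; last exact: le_lt_trans (le_wnorm _ _ ba) aoo.
by exists C, M => xi; exact: le_trans (aC xi).
Qed.

Lemma wspace_finite_support a A : (forall xi, xi \notin A -> a xi = 0) -> X a.
Proof.
move=> aA; split; last exact: wnorm_finite_support aA.
exists (\sum_(xi <- A) normc (a xi)), 0 => xi; rewrite powRr0 mulr1.
rewrite -[leLHS](big_seq_fset1 +%R xi (fun eta => normc (a eta))).
by apply: ler_fsum_supp => [eta|eta /aA ->]; rewrite ?normc0 ?normc_ge0.
Qed.

Lemma wnorm_unit_seq xi : (N (unit_seq xi) <= (alpha xi)%:E)%E.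
Proof.
apply/wnorm_le_finite => [//||A]; first exact: ltW.
rewrite (le_trans (ler_fsum_supp (A := [fset xi]%fset) _ _ _))//.
- by move=> eta; exact: powR_ge0.
- move=> eta; rewrite inE /unit_seq => /negPf ->.
  by rewrite normc0 mul0r powR0// gt_eqF.
- by rewrite big_seq_fset1 /unit_seq eqxx normc1 mul1r.
Qed.

(** Density of the finitely supported sequences; this is where p < oo matters.
    The difference is written in the shape of the linear combinations for which
    functionals are assumed to be linear. *)
Lemma wnorm_trunc_compl a (e : R) : X a -> 0 < e ->
  exists A, forall B, (A `<=` B)%fset ->
    (N (fun xi => (- 1) * trunc B a xi + a xi)%R <= e%:E)%E.
Proof.
move=> [_ aoo] e0.
have soo : (\esum_(xi in [set: I]) ((normc (a xi) * alpha xi) `^ p)%:E < +oo)%E.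
  by move: aoo; rewrite /wnorm; apply: lty_poweRy; rewrite invr_eq0 gt_eqF.
have [A Ae] := esum_tail (fun xi => powR_ge0 _ _) soo (powR_gt0 p e0).
exists A => B AB; apply/wnorm_le_finite => [//||C]; first exact: ltW.
rewrite (le_trans _ (Ae B C AB))//; apply: ler_sum => xi _; rewrite /trunc.
case: ifPn => _; last by rewrite mulr0 add0r.
by rewrite mulN1r addNr normc0 mul0r powR0// gt_eqF.
Qed.

Section functional.
Variable F : (I -> R[i]) -> R[i].
Hypothesis F_dual : dual_space X N F.

Lemma dual_space_le : exists2 M : R, 0 <= M &
  forall a t, X a -> 0 <= t -> (N a <= t%:E)%E -> normc (F a) <= M * t.
Proof.
have [_ [M FM]] := F_dual; exists `|M| => // a t Xa t0 at_.
have := FM a Xa; rewrite wnorm_fineK; last by case: Xa.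
rewrite -EFinM lee_fin => /le_trans; apply.
have Na0 : 0 <= fine (N a) by rewrite fine_ge0// wnorm_ge0.
rewrite (le_trans (ler_wpM2r Na0 (ler_norm M)))// ler_wpM2l//.
by rewrite -lee_fin -wnorm_fineK//; case: Xa.
Qed.

Lemma dual_space_finite_support a A : (forall xi, xi \notin A -> a xi = 0) ->
  F a = \sum_(xi <- A) a xi * F (unit_seq xi).
Proof.
have [Flin _] := F_dual.
move=> aA; have {1}-> : a = fun eta => \sum_(xi <- A) a xi * unit_seq xi eta.
  apply/funext => eta; rewrite /unit_seq; have [etaA|etaA] := boolP (eta \in A).
    rewrite (bigD1_seq eta)//= eqxx mulr1 big1 ?addr0// => xi.
    by rewrite eq_sym => /negPf ->; rewrite mulr0.
  rewrite aA// big1_seq// => xi /= xiA; have [eta_xi|] := eqVneq; last by rewrite mulr0.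
  by rewrite -eta_xi (negPf etaA) in xiA.
move: (enum_fset A) => s; elim: s => [|xi s IH].
  rewrite big_nil; under [X in F X]eq_fun do rewrite big_nil.
  have X0 : X (fun=> 0) by exact: (@wspace_finite_support _ fset0).
  have := Flin (- 1) _ _ X0 X0; under [X in F X]eq_fun do rewrite mulr0 addr0.
  by rewrite mulN1r addNr.
rewrite big_cons -IH -Flin.
- by congr F; apply/funext => eta; rewrite big_cons.
- apply: (@wspace_finite_support _ [fset xi]%fset) => eta.
  by rewrite inE /unit_seq => /negPf ->.
- apply: (@wspace_finite_support _ [fset eta in s]%fset) => eta.
  rewrite inE/= => etas; rewrite big1_seq// => z /= zs; rewrite /unit_seq.
  by have [ez|] := eqVneq eta z; [rewrite ez zs in etas|rewrite mulr0].
Qed.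

Definition coefficients : I -> R[i] := fun xi => F (unit_seq xi).

(** The coefficients are bounded by the norms of the unit sequences, hence by a
    multiple of alpha, and alpha is tempered; their norm is finite by the
    converse of Hoelder's inequality. *)
Lemma coefficients_wspace : Y coefficients.
Proof.
have [M M0 FM] := dual_space_le; split.
- have [C [K aC]] := alpha_tempered; exists (M * C), K => xi.
  rewrite -mulrA (le_trans _ (ler_wpM2l M0 (aC xi)))//.
  apply: FM; [|exact: ltW|exact: wnorm_unit_seq].
  apply: (@wspace_finite_support _ [fset xi]%fset) => eta.
  by rewrite inE /unit_seq => /negPf ->.
- apply: (@le_lt_trans _ _ M%:E); last exact: ltry.
  apply: (wnorm_dual_le alpha_gt0 p_ge1 pq M0) => a A aA a1.
  rewrite -dual_space_finite_support// -[M]mulr1.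
  by apply: FM => //; exact: wspace_finite_support aA.
Qed.

(** On a finite set B the partial sum is the value of F at the truncation to B,
    so the error is the value of F at the remainder, which is small in norm. *)
Lemma coefficients_represent : represents X coefficients F.
Proof.
move=> a Xa; have [Flin _] := F_dual; have [M M0 FM] := dual_space_le.
apply/has_sumP => e e0.
have e'0 : 0 < e / (M + 1) by rewrite divr_gt0// ltr_wpDl.
have [A Ae] := wnorm_trunc_compl Xa e'0; exists A => B AB.
have XB : X (trunc B a).
  by apply: (@wspace_finite_support _ B) => xi /negPf xiB; rewrite /trunc xiB.
have := FM _ _ _ (ltW e'0) (Ae B AB); rewrite Flin//.
rewrite (@dual_space_finite_support (trunc B a) B); last first.
  by move=> xi /negPf xiB; rewrite /trunc xiB.
rewrite (eq_big_seq (fun xi => a xi * coefficients xi)); last first.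
  by move=> xi xiB; rewrite /trunc xiB.
set S := \sum_(_ <- _) _ => /(_ _)/le_trans H.
rewrite -normc_opp opprB addrC -mulN1r; apply: H.
  apply: wspace_sub Xa => xi; rewrite /trunc.
  by case: ifPn => _; rewrite ?mulr0 ?add0r// mulN1r addNr normc0 normc_ge0.
by rewrite mulrCA ler_piMr ?(ltW e0)// ler_pdivrMr ?ltr_wpDl// mul1r lerDl.
Qed.

End functional.

Lemma represents_unit_seq b F : represents X b F -> forall xi, b xi = F (unit_seq xi).
Proof.
move=> bF xi.
have d0 eta : eta \notin [fset xi]%fset -> unit_seq xi eta = 0.
  by rewrite inE /unit_seq => /negPf ->.
have h1 := bF _ (wspace_finite_support d0).
have h2 : has_sum (fun eta => unit_seq xi eta * b eta)
    (\sum_(eta <- [fset xi]%fset) unit_seq xi eta * b eta).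
  by apply: has_sum_finite => eta /d0 ->; rewrite mul0r.
rewrite (has_sum_unique h1 h2) big_seq_fset1 /unit_seq eqxx mul1r//.
Qed.

Section pairing.
Variable b : I -> R[i].
Hypothesis Yb : Y b.

Lemma pairing_le a A : X a ->
  \sum_(xi <- A) normc (a xi * b xi) <= fine (N a) * fine (N' b).
Proof.
move=> [_ aoo]; have [_ boo] := Yb.
by apply: (wnorm_hoelder _ alpha_gt0 p_ge1 pq);
  rewrite ?fine_ge0 ?wnorm_ge0// -wnorm_fineK.
Qed.

Definition pairing a : R[i] := xget 0 [set l | has_sum (fun xi => a xi * b xi) l].

Lemma pairingP a : X a -> has_sum (fun xi => a xi * b xi) (pairing a).
Proof.
move=> Xa; have [l h] := abs_summable_has_sum (fun A => pairing_le A Xa).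
exact: (xgetI 0 h).
Qed.

Lemma pairing_norm_le a : X a -> normc (pairing a) <= fine (N a) * fine (N' b).
Proof.
by move=> Xa; apply: has_sum_norm_le (pairingP Xa) => A; exact: pairing_le.
Qed.

Lemma pairing_dual_space : dual_space X N pairing.
Proof.
split=> [c a a' Xa Xa'|].
  have h := has_sum_lin c (pairingP Xa) (pairingP Xa').
  rewrite (_ : (fun xi => _) = (fun xi => (c * a xi + a' xi) * b xi)) in h; last first.
    by apply/funext => xi; ring.
  exact: has_sum_unique (xgetI 0 h) h.
exists (fine (N' b)) => a Xa; rewrite [N a]wnorm_fineK; last by case: Xa.
by rewrite -EFinM lee_fin mulrC pairing_norm_le.
Qed.

(** One inequality is Hoelder's; for the other, the dual norm bounds the pairing
    with the finitely supported sequences of norm at most 1, and these detect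
    the norm of b. *)
Lemma dual_norm_pairing : dual_norm X N pairing = N' b.
Proof.
have [_ boo] := Yb.
have N'b0 : 0 <= fine (N' b) by rewrite fine_ge0// wnorm_ge0.
apply/eqP; rewrite eq_le; apply/andP; split.
  apply: ge_ereal_sup => _ [a [Xa a1] <-].
  rewrite [N' b]wnorm_fineK// lee_fin (le_trans (pairing_norm_le Xa))//.
  by rewrite ler_piMl// -lee_fin -wnorm_fineK//; case: Xa.
set D := dual_norm _ _ _.
have Dub a : X a -> (N a <= 1)%E -> ((normc (pairing a))%:E <= D)%E.
  by move=> Xa a1; apply: ereal_sup_ubound; exists a.
have X0 : X (fun=> 0) by exact: (@wspace_finite_support _ fset0).
have D0 : (0 <= D)%E.
  apply: le_trans (Dub _ X0 _); first by rewrite lee_fin normc_ge0.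
  apply/wnorm_le_finite => // A; rewrite powR1 big1// => xi _.
  by rewrite normc0 mul0r powR0// gt_eqF.
move: Dub D0; case: D => [D||]//= Dub D0; last by rewrite leey.
apply: (wnorm_dual_le alpha_gt0 p_ge1 pq D0) => a A aA a1.
have Xa := wspace_finite_support aA.
rewrite -lee_fin (le_trans _ (Dub a Xa a1))// lee_fin.
have h : has_sum (fun xi => a xi * b xi) (\sum_(xi <- A) a xi * b xi).
  by apply: has_sum_finite => xi /aA ->; rewrite mul0r.
by rewrite (has_sum_unique (pairingP Xa) h).
Qed.

End pairing.

Theorem weighted_dual_identified : dual_identified X N Y N'.
Proof.
split=> [b Yb|F F_dual].
  exists (pairing b); split; [exact: pairing_dual_space| |exact: dual_norm_pairing].
  by move=> a Xa; exact: pairingP.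
exists (coefficients F); split.
  by split; [exact: coefficients_wspace|exact: coefficients_represent].
by move=> b [_ bF]; apply/funext => xi; rewrite (represents_unit_seq bF).
Qed.

End weighted_duality.

(** * The spaces l^p(L) and l^p(L^* ) as weighted spaces *)

Section lp_spaces.
Context {R : realType} {I : choiceType}.
Implicit Types (wu wv jap : I -> R).

Definition lp_weight wu wv (p : R) : I -> R :=
  fun xi => (if p <= 2 then wu else wv) xi `^ ((2 - p) / p).

Lemma lp_norm_wnorm wu wv (p : R) : 0 < p ->
  lp_norm wu wv p%:E = wnorm (lp_weight wu wv p) p%:E.
Proof.
move=> p0; apply/funext => a; rewrite /lp_norm /wnorm /lp_weight.
congr poweR; apply: eq_esum => xi _; congr EFin.
by rewrite powRM ?normc_ge0 ?powR_ge0// -powRrM divfK// gt_eqF.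
Qed.

(** p < 2 exactly when r > 2, so both weights are powers of the same sup norms,
    with opposite exponents 2/p - 1 and 2/r - 1.  At p = r = 2 the sup norms
    differ but both exponents are 0. *)
Lemma lp_weight_conjugate wu wv (p r : R) xi : 1 < p -> 1 < r -> p^-1 + r^-1 = 1 ->
  lp_weight wv wu r xi = (lp_weight wu wv p xi)^-1.
Proof.
move=> p1 r1 pr; rewrite /lp_weight -powRN.
have [p0 r0] : 0 < p /\ 0 < r by split; exact: lt_trans ltr01 _.
have pE : (2 - p) / p = 2 * p^-1 - 1 by rewrite mulrBl divff ?gt_eqF.
have rE : (2 - r) / r = 2 * r^-1 - 1 by rewrite mulrBl divff ?gt_eqF.
have -> : (2 - r) / r = - ((2 - p) / p) by rewrite pE rE; lra.
have [p2|p2|->] := ltgtP p 2.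
- have : 2^-1 < p^-1 by rewrite ltf_pV2 ?posrE.
  have [r2|//] := leP r 2.
  have : 2^-1 <= r^-1 by rewrite lef_pV2 ?posrE.
  lra.
- have : p^-1 < 2^-1 by rewrite ltf_pV2 ?posrE.
  have [//|r2] := leP r 2.
  have : r^-1 < 2^-1 by rewrite ltf_pV2 ?posrE.
  lra.
- by rewrite subrr mul0r oppr0 !powRr0.
Qed.

Lemma lp_norm_dual_wnorm wu wv (p : R) (q : \bar R) : 1 <= p ->
  (p%:E^-1 + q^-1 = 1)%E ->
  (forall xi, 0 < wu xi) ->
  lp_norm wv wu q = wnorm (fun xi => (lp_weight wu wv p xi)^-1)%R q.
Proof.
move=> p1 pq wu0; apply/funext => b.
have [[-> ->]|[r [-> {}p1 r1 pr]]] := conjugate_exponents p1 pq.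
  have -> // : lp_weight wu wv 1 = wu.
  apply/funext => xi; rewrite /lp_weight ler1n (_ : (2 - 1) / 1 = 1); last by field.
  by rewrite powRr1// ltW.
rewrite lp_norm_wnorm//; last exact: lt_trans r1.
have -> // : lp_weight wv wu r = (fun xi => (lp_weight wu wv p xi)^-1).
by apply/funext => xi; exact: lp_weight_conjugate.
Qed.

(** For p > 2 the exponent (2 - p)/p is negative: the weight is bounded because
    the sup norms are bounded below. *)
Lemma lp_weight_tempered jap wu wv (p c : R) : 1 <= p -> 0 < c ->
  (forall xi, 0 < wu xi) -> (forall xi, c <= wv xi) ->
  (p < 2 -> exists C M : R, forall xi, wu xi <= C * jap xi `^ M) ->
  exists C M : R, forall xi, lp_weight wu wv p xi <= C * jap xi `^ M.
Proof.
move=> p1 c0 wu0 cv wu_temp; have p0 : 0 < p by exact: lt_le_trans p1.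
rewrite /lp_weight; have [p2|p2|->] := ltgtP p 2; last 2 first.
- exists (c `^ ((2 - p) / p)), 0 => xi; rewrite powRr0 mulr1.
  have s0 : 0 <= - ((2 - p) / p) by rewrite -mulNr opprB divr_ge0 ?subr_ge0 ?(ltW p2) ?(ltW p0).
  have wv0 : 0 < wv xi by exact: lt_le_trans (cv xi).
  rewrite -[(2 - p) / p]opprK !(powRN _ (- _)) lef_pV2 ?posrE ?powR_gt0//.
  by rewrite ge0_ler_powR ?nnegrE ?(ltW c0) ?(ltW wv0).
- by exists 1, 0 => xi; rewrite subrr mul0r !powRr0 mulr1.
have [C [M wuC]] := wu_temp p2.
have s0 : 0 <= (2 - p) / p by rewrite divr_ge0 ?subr_ge0 // ltW.
exists (`|C| `^ ((2 - p) / p)), (M * ((2 - p) / p)) => xi.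
rewrite powRrM -powRM ?powR_ge0//.
rewrite ge0_ler_powR ?nnegrE ?(mulr_ge0 (normr_ge0 C)) ?powR_ge0//.
  exact: ltW.
by rewrite (le_trans (wuC xi))// ler_wpM2r ?powR_ge0// ler_norm.
Qed.

Theorem lp_dual_identified jap wu wv (p c : R) (q : \bar R) :
  1 <= p -> (p%:E^-1 + q^-1 = 1)%E -> 0 < c ->
  (forall xi, 0 < wu xi) -> (forall xi, c <= wv xi) ->
  (p < 2 -> exists C M : R, forall xi, wu xi <= C * jap xi `^ M) ->
  dual_identified
    (lp_space jap wu wv p%:E) (lp_norm wu wv p%:E)
    (lp_space jap wv wu q) (lp_norm wv wu q).
Proof.
move=> p1 pq c0 wu0 cv wu_temp.
have wv0 xi : 0 < wv xi by exact: lt_le_trans (cv xi).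
rewrite /lp_space (lp_norm_dual_wnorm _ p1 pq wu0) lp_norm_wnorm//; last first.
  exact: lt_le_trans p1.
apply: weighted_dual_identified => //; last exact: (lp_weight_tempered p1 c0).
by move=> xi; rewrite powR_gt0//; case: ifPn.
Qed.

End lp_spaces.

(** * Lower bound for the sup norms of a Riesz basis *)

(** The integral of [f] is a supremum over the simple functions below [f]; each
    of them is measurable and almost everywhere below [g], which bounds its
    integral. *)
Lemma ae_ge0_le_integral_dominating d (T : measurableType d) (R : realType)
    (mu : {measure set T -> \bar R}) (f g : T -> \bar R) :
  (forall x, (0 <= f x)%E) -> (forall x, (0 <= g x)%E) ->
  measurable_fun [set: T] g ->
  {ae mu, forall x, (f x <= g x)%E} ->
  (\int[mu]_x f x <= \int[mu]_x g x)%E.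
Proof.
move=> f0 g0 mg fg; rewrite ge0_integralTE//; apply: ge_ereal_sup => _ [h hf <-].
rewrite -integralT_nnsfun; apply: ae_ge0_le_integral => //.
- by move=> x _; rewrite lee_fin.
- exact/measurable_EFinP/measurable_funPT.
- by move: fg; apply: filterS => x fgx _; exact: le_trans (hf x) fgx.
Qed.

Lemma Lnorm_le_Lnorm_infty d (T : measurableType d) (R : realType)
    (mu : {measure set T -> \bar R}) (B : set T) (f : T -> R) (r C : R) :
  measurable B -> 0 < r -> 0 <= C -> (forall x, ~ B x -> f x = 0) ->
  (Lnorm mu +oo%E (EFin \o f) <= C%:E)%E ->
  (Lnorm mu r%:E (EFin \o f) <= C%:E * poweR (mu B) r^-1)%E.
Proof.
move=> mB r0 C0 fB fC.
have aeC : {ae mu, forall x, (`|(f x)%:E| <= C%:E)%E}.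
  move: fC; rewrite unlock; case: ifPn => [_ /ess_supP//|].
  rewrite -leNgt measure_le0 => /eqP mu0 _.
  by exists setT; split => //.
have CE : C%:E = poweR (C `^ r)%:E r^-1 :> \bar R.
  by rewrite poweR_EFin -powRrM mulfV ?gt_eqF// powRr1.
rewrite unlock CE -poweRM ?lee_fin ?powR_ge0//.
have -> : ((C `^ r)%:E * mu B = \int[mu]_x ((C `^ r)%:E * (\1_B x)%:E))%E.
  by rewrite ge0_integralZl ?lee_fin ?powR_ge0//
    ?integral_indic ?setIT//; exact/measurable_EFinP/measurable_indic.
have ge0 (h : T -> \bar R) : (forall x, 0 <= h x)%E ->
    (\int[mu]_x h x)%E \in `[0%E, +oo%E].
  by move=> h0; rewrite in_itv/= leey andbT integral_ge0.
have ind0 x : (0 <= (C `^ r)%:E * (\1_B x)%:E)%E.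
  by rewrite mule_ge0// lee_fin ?powR_ge0.
apply: gt0_ler_poweR; rewrite ?invr_ge0 ?(ltW r0)//.
- by apply: ge0 => x; exact: poweR_ge0.
- exact: ge0.
apply: ae_ge0_le_integral_dominating => //.
- by move=> x; exact: poweR_ge0.
- by apply: measurable_funeM; exact/measurable_EFinP/measurable_indic.
apply: filterS aeC => x /=; rewrite !lee_fin indicE.
have [Bx|/fB ->] := pselect (B x) => fxC.
  by rewrite mem_set// mulr1 ge0_ler_powR// ?nnegrE ?(ltW r0).
by rewrite normr0 powR0 ?gt_eqF// mulr_ge0 ?powR_ge0.
Qed.

(** The cube is built along the recursive definition of the measure, so that it
    is a product at each stage. *)
Lemma lebesgue_rV_cube_finite (R : realType) (n : nat) (M : R) :
  exists B : set 'rV[R]_n, [/\ measurable B,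
    (forall x : 'rV[R]_n, (forall i, `|x ord0 i| <= M) -> B x) &
    (lebesgue_rV n B < +oo)%E].
Proof.
elim: n => [|n [B [mB MB muB]]].
  by exists setT; split => //=; rewrite diracT ltry.
exists (@rV_uncons R n @^-1` (`[-M, M]%classic `*` B)); split.
- rewrite -[X in measurable X]setTI; apply: measurable_rV_uncons => //.
  exact: measurableX.
- move=> x xM; split => /=; last by apply: MB => i; rewrite mxE.
  by rewrite in_itv/= -ler_norml.
- rewrite /= /lebesgue_rV_succ /pushforward -comp_preimage.
  rewrite (_ : _ \o _ = id); last exact/funext/rV_consK.
  rewrite preimage_id product_measure1E// lte_mul_pinfty//.
  rewrite (_ : _ `[- M, M]%classic = lebesgue_measure `[- M, M]%classic)//.
  by rewrite lebesgue_measure_itv/=; case: ifPn => // _; rewrite -EFinB.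
Qed.

(** The lower Riesz bound for a single coefficient equal to 1 bounds the L^2
    norms below, and a bounded domain has finite measure, so that the L^2 norm
    is at most a constant times the sup norm. *)
Lemma riesz_basis_Linfty_norm_lower_bound (R : realType) (n : nat)
    (Omega : set 'rV[R]_n) (I : choiceType) (u : I -> 'rV[R]_n -> R[i]) :
  bounded_set Omega -> riesz_basis Omega u ->
  (forall xi, Linfty Omega (u xi)) ->
  exists2 c : R, 0 < c & forall xi, c <= Linfty_norm Omega (u xi).
Proof.
move=> [M [_ OmegaM]] [_ _ [a [b [a0 _ riesz]]]] uoo.
have [B [mB MB muB]] := lebesgue_rV_cube_finite n (M + 1).
have OB x : Omega x -> B x.
  move=> Ox; apply: MB => i.
  apply: le_trans (OmegaM (M + 1) _ x Ox); last by rewrite ltrDl.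
  rewrite [leRHS]mx_normrE.
  exact: (le_bigmax _ (fun j : 'I_1 * 'I_n => `|x j.1 j.2|) (ord0, i)).
pose V := fine (lebesgue_rV n B).
have VE : lebesgue_rV n B = V%:E by rewrite /V fineK// ge0_fin_numE.
have V0 : 0 <= V by exact: fine_ge0.
have low xi : Num.sqrt a <= Linfty_norm Omega (u xi) * V `^ 2^-1.
  have [_ uoo_lt] := uoo xi.
  have uooE : Lp_norm Omega +oo%E (u xi) = (Linfty_norm Omega (u xi))%:E.
    by rewrite fineK// ge0_fin_numE// Lnorm_ge0.
  have Linf0 : 0 <= Linfty_norm Omega (u xi) by rewrite fine_ge0// Lnorm_ge0.
  have : (Lp_norm Omega 2%:E (u xi) <=
      (Linfty_norm Omega (u xi))%:E * poweR (lebesgue_rV n B) 2^-1)%E.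
    apply: Lnorm_le_Lnorm_infty => //; last by rewrite -uooE.
    move=> x Bx; rewrite indicE memNset ?mulr0//.
    by move=> /OB.
  rewrite VE poweR_EFin -EFinM => L2le.
  have L2fin : Lp_norm Omega 2%:E (u xi) = (L2norm Omega (u xi))%:E.
    by rewrite fineK// ge0_fin_numE ?Lnorm_ge0// (le_lt_trans L2le) ?ltry.
  move: L2le; rewrite L2fin lee_fin; apply: le_trans.
  have /andP[+ _] := riesz [fset xi]%fset (fun=> 1).
  have -> : lin_comb [fset xi]%fset (fun=> 1) u = u xi.
    by apply/funext => x; rewrite /lin_comb big_seq_fset1 mul1r.
  rewrite big_seq_fset1 normc1 expr1n mulr1 => aL2.
  have L20 : 0 <= L2norm Omega (u xi) by rewrite fine_ge0// Lnorm_ge0.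
  by rewrite -(ger0_norm L20) -sqrtr_sqr ler_wsqrtr.
exists (Num.sqrt a / (V `^ 2^-1 + 1)).
  by rewrite divr_gt0 ?sqrtr_gt0// ltr_wpDl ?powR_ge0.
move=> xi; rewrite ler_pdivrMr ?ltr_wpDl ?powR_ge0// (le_trans (low xi))//.
by rewrite ler_wpM2l ?lerDl// fine_ge0// Lnorm_ge0.
Qed.

(** * Duality of the spaces l^p(L) and l^p(L^* ) *)

(* [u_tempered] and [v_tempered] say that the sup norms of the eigenfunctions
   are themselves in S'(I).  For p < 2 the dual of l^p is contained in S'(I),
   hence in l^p', only if this holds. *)
Theorem theorem7p7 (R : realType) (n m K : nat) (Omega : set 'rV[R]_n)
  (L Ls : operator n) (I : set 'rV[int]_K) (lam : I -> R[i])
  (u v : I -> 'rV[R]_n -> R[i]) (p : R) (p' : \bar R)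
  (n_gt0 : (0 < n)%N) (m_gt0 : (0 < m)%N)
  (Omega_open : open Omega) (Omega_bounded : bounded_set Omega)
  (L_linear : L2_linear Omega L) (L_diff : differential_operator Omega m L)
  (Ls_adjoint : is_adjoint Omega L Ls)
  (L_spectrum : discrete_spectrum Omega L lam u)
  (lam_order : forall j k : I,
     euclid_norm (val j) <= euclid_norm (val k) :> R ->
     normc (lam j) <= normc (lam k))
  (u_eigen : forall xi, eigenfunction Omega L (lam xi) (u xi))
  (v_eigen : forall xi, eigenfunction Omega Ls (conjc (lam xi)) (v xi))
  (u_norm : forall xi, L2norm Omega (u xi) = 1)
  (uv_biorth : forall xi eta, inner Omega (u xi) (v eta) = (xi == eta)%:R)
  (u_riesz : riesz_basis Omega u) (v_riesz : riesz_basis Omega v)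
  (L_complete : dom_infty_complete Omega L)
  (Ls_complete : dom_infty_complete Omega Ls)
  (u_bounded : forall xi, Linfty Omega (u xi))
  (v_bounded : forall xi, Linfty Omega (v xi))
  (u_tempered : p < 2 ->
     tempered (japanese m lam) (fun xi => (Linfty_norm Omega (u xi))%:C))
  (v_tempered : p < 2 ->
     tempered (japanese m lam) (fun xi => (Linfty_norm Omega (v xi))%:C))
  (p_ge1 : 1 <= p) (pp' : (p%:E^-1 + p'^-1 = 1)%E) :
  let jap := japanese m lam in
  let wu := fun xi => Linfty_norm Omega (u xi) in
  let wv := fun xi => Linfty_norm Omega (v xi) in
  dual_identified
    (lp_space jap wu wv p%:E) (lp_norm wu wv p%:E)
    (lp_space jap wv wu p') (lp_norm wv wu p') /\
  dual_identified
    (lp_space jap wv wu p%:E) (lp_norm wv wu p%:E)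
    (lp_space jap wu wv p') (lp_norm wu wv p').
Proof.
move=> jap wu wv.
have [c c0 cu] :=
  riesz_basis_Linfty_norm_lower_bound Omega_bounded u_riesz u_bounded.
have [d d0 dv] :=
  riesz_basis_Linfty_norm_lower_bound Omega_bounded v_riesz v_bounded.
have growth (w : I -> R) : tempered jap (fun xi => (w xi)%:C) ->
    exists C M : R, forall xi, w xi <= C * jap xi `^ M.
  case=> C [M wC]; exists C, M => xi; apply: le_trans (wC xi).
  by rewrite normcR ler_norm.
split.
- apply: (lp_dual_identified p_ge1 pp' d0 _ dv) => [xi|p2].
    exact: lt_le_trans (cu xi).
  exact/growth/u_tempered.
- apply: (lp_dual_identified p_ge1 pp' c0 _ cu) => [xi|p2].
    exact: lt_le_trans (dv xi).
  exact/growth/v_tempered.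
Qed.
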